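(* Let $q>1$ be an integer. The functions $G_+$ and $G_-$, defined near $0$ by the power series $$G_+(z)=\sum_{n\ge 1}\zeta_q(n)z^n,\qquad G_-(z)=\sum_{n\ge 0}\zeta_q(-n)z^n,$$ admit analytic continuations to $\mathbb P^1(\mathbb C)\setminus\Omega_q^{+}$ and $\mathbb P^1(\mathbb C)\setminus\Omega_q^{-}$, respectively. Moreover, for all $z$ outside $\Omega_q^+$, these continuations satisfy $$G_+(z)+G_-\left(\frac1z\right)=0.$$
   Context: For an integer $q\ge 2$, let $T_{q+1}$ be the regular tree of degree $q+1$, with adjacency operator $A$, combinatorial Laplacian $\Delta_q=(q+1)-A$ acting on $\ell^2(T_{q+1})$, and a fixed vertex $\mathbf 0$. The spectral zeta function of $T_{q+1}$ is the entire function $$\zeta_q(s)=\langle \Delta_q^{-s}\delta_{\mathbf 0}\mid\delta_{\mathbf 0}\rangle=\frac{q+1}{2\pi}\int_{-2\sqrt q}^{2\sqrt q}(q+1-\lambda)^{-s}\,\frac{\sqrt{4q-\lambda^2}}{(q+1)^2-\lambda^2}\,\mathrm d\lambda ,\qquad s\in\mathbb C.$$ Let $\Omega_q^+=[(\sqrt q-1)^2,(\sqrt q+1)^2]$ (the spectrum of $\Delta_q$), and let $\Omega_q^-$ be the image of $\Omega_q^+$ under $z\mapsto 1/z$. $\mathbb P^1(\mathbb C)=\mathbb C\cup\{\infty\}$ denotes the Riemann sphere, with $1/0=\infty$ and $1/\infty=0$. *)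

(* Defs.v *)
From Stdlib Require Import Reals.
From Coquelicot Require Import Coquelicot.
Open Scope R_scope.

Definition Cexp (z : C) : C :=
  Cmult (RtoC (exp (Re z))) (cos (Im z), sin (Im z)).

(* [x ^ s] for [x > 0] real and [s] complex, with the real logarithm of [x]. *)
Definition pos_Cpow (x : R) (s : C) : C := Cexp (Cmult s (RtoC (ln x))).

(* The spectral zeta function <Delta^{-s} delta_0, delta_0> of the
   (q+1)-regular tree, where Delta = (q+1) - A: the integral of
   [(q + 1 - lambda)^{-s}] against the spectral measure of the adjacency
   operator A at the root.
   For [q >= 2] the base [q + 1 - lambda] is positive and the denominator
   [(q + 1)^2 - lambda^2] nonzero on the whole interval of integration, since
   [2 * sqrt q < q + 1]; the integrand is therefore continuous there. *)
Definition zeta (q : nat) (s : C) : C :=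
  Cmult (RtoC ((INR q + 1) / (2 * PI)))
    (RInt (V := C_R_CompleteNormedModule)
       (fun lambda : R =>
          Cmult (pos_Cpow (INR q + 1 - lambda) (Copp s))
            (RtoC (sqrt (4 * INR q - lambda ^ 2)
                   / ((INR q + 1) ^ 2 - lambda ^ 2))))
       (- (2 * sqrt (INR q))) (2 * sqrt (INR q))).

Definition Gplus_coef (q n : nat) : C :=
  match n with
  | O => RtoC 0
  | S _ => zeta q (RtoC (INR n))
  end.

Definition Gminus_coef (q n : nat) : C := zeta q (RtoC (- INR n)).

Inductive P1C : Set :=
  | Fin : C -> P1C
  | Inf : P1C.

Definition P1C_inv (p : P1C) : P1C :=
  match p with
  | Fin z => if Ceq_dec z (RtoC 0) then Inf else Fin (Cinv z)
  | Inf => Fin (RtoC 0)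
  end.

Definition Omega_plus (q : nat) (p : P1C) : Prop :=
  exists x : R,
    (sqrt (INR q) - 1) ^ 2 <= x <= (sqrt (INR q) + 1) ^ 2 /\ p = Fin (RtoC x).

Definition Omega_minus (q : nat) (p : P1C) : Prop :=
  exists p' : P1C, Omega_plus q p' /\ p = P1C_inv p'.

Definition analytic_at (f : C -> C) (z0 : C) : Prop :=
  exists a : nat -> C,
    locally (T := C_UniformSpace) z0
      (fun z : C =>
         is_pseries (K := C_AbsRing) (V := C_NormedModule)
           a (Cminus z z0) (f z)).

(* At infinity, analyticity is read in the chart [w = 1/z]. *)
Definition P1C_analytic_at (F : P1C -> C) (p : P1C) : Prop :=
  match p with
  | Fin z0 => analytic_at (fun z : C => F (Fin z)) z0
  | Inf => analytic_at (fun w : C => F (P1C_inv (Fin w))) (RtoC 0)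
  end.

(* [F] is total; its values outside [U], away from [0], are irrelevant.  The
   first clause includes the convergence of the series near [0]. *)
Definition analytic_continuation
    (a : nat -> C) (U : P1C -> Prop) (F : P1C -> C) : Prop :=
  locally (T := C_UniformSpace) (RtoC 0)
    (fun z : C =>
       is_pseries (K := C_AbsRing) (V := C_NormedModule) a z (F (Fin z))) /\
  (forall p : P1C, U p -> P1C_analytic_at F p).

(* Main.v *)
Require Import Defs.
From Stdlib Require Import Reals Lra.
From Coquelicot Require Import Coquelicot.

(** The reason behind the functional equation is that both series are Stieltjes
    transforms of one measure.  Put [u = q + 1 - x] and let [rho] be the
    spectral density of the adjacency operator, so that
    [zeta q s = int rho u^(-s)] over [[-2 sqrt q, 2 sqrt q]].  Summing
    geometric series under the integral gives, near [0],
    - [sum_(n >= 0) zeta(-n) z^n = int rho / (1 - u z)],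
    - [sum_(n >= 1) zeta(n) z^n = int rho / (1 - z / u) - zeta 0].

    The right-hand sides make sense as soon as the denominators do not vanish,
    that is, off [Omega_minus] and off [Omega_plus] respectively, and they are
    the required continuations.  The identity [G_+(z) + G_-(1/z) = 0] is then
    the integrated form of [1/(1 - z/u) + 1/(1 - u/z) = 1].

    Everything rests on the integrals [int g / (1 - v z)] for continuous real
    [g] and [v].  Their analyticity ([resolvent_integral_expansion]) comes from
    rewriting [g / (1 - v z)] as [p / (1 - h (z - z0))] with
    [p = g / (1 - v z0)] and [h = v / (1 - v z0)], and expanding the latter
    termwise ([moment_series]).  The same lemma at [z0 = 0] identifies the
    Taylor coefficients with values of [zeta].  The reflection
    [z -> 1/z] ([resolvent_integral_reflection]) exchanges [v] and [1/v], up to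
    sign and a constant; it yields the functional equation and also the
    analyticity at infinity, since it turns either continuation in the chart
    [1/z] into the other one near [0]. *)

(** * Complex-valued functions of a real variable *)

Local Notation CRint := (RInt (V := C_R_CompleteNormedModule)).
Local Notation ex_CRint := (ex_RInt (V := C_R_NormedModule)).
Local Notation is_CRint := (is_RInt (V := C_R_NormedModule)).
Local Notation Ccontinuous f x :=
  (continuous (f : R_UniformSpace -> C_UniformSpace) x).
Local Notation is_Cpseries :=
  (is_pseries (K := C_AbsRing) (V := C_NormedModule)).

Lemma continuous_Rpow (f : R -> R) (n : nat) (x : R) :
  continuous f x -> continuous (fun t => f t ^ n)%R x.
Proof.
intros Hf; induction n as [|n IH]; simpl; [apply continuous_const|].
now apply (continuous_mult (K := R_AbsRing)).
Qed.

Lemma Ccontinuous_intro (f : R -> C) (x : R) :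
  continuous (fun t => Re (f t)) x -> continuous (fun t => Im (f t)) x ->
  Ccontinuous f x.
Proof.
intros Hre Him.
apply (continuous_ext (fun t => (Re (f t), Im (f t)))).
  intros t; unfold Re, Im; destruct (f t); reflexivity.
apply (continuous_comp_2 (fun t => Re (f t)) (fun t => Im (f t))
  (fun u v : R => (u, v)) x Hre Him).
apply (continuous_ext (fun p : R * R => p)); [intros [u v]; reflexivity|].
apply continuous_id.
Qed.

Lemma continuous_Re (f : R -> C) (x : R) :
  Ccontinuous f x -> continuous (fun t => Re (f t)) x.
Proof.
intros Hf; apply (continuous_comp (f : R -> R * R) fst x Hf).
destruct (f x) as [u v]; apply continuous_fst.
Qed.

Lemma continuous_Im (f : R -> C) (x : R) :
  Ccontinuous f x -> continuous (fun t => Im (f t)) x.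
Proof.
intros Hf; apply (continuous_comp (f : R -> R * R) snd x Hf).
destruct (f x) as [u v]; apply continuous_snd.
Qed.

Lemma Ccontinuous_RtoC (f : R -> R) (x : R) :
  continuous f x -> Ccontinuous (fun t => RtoC (f t)) x.
Proof.
intros Hf; apply Ccontinuous_intro; simpl; [exact Hf|apply continuous_const].
Qed.

Lemma Ccontinuous_minus (f g : R -> C) (x : R) :
  Ccontinuous f x -> Ccontinuous g x -> Ccontinuous (fun t => (f t - g t)%C) x.
Proof.
intros Hf Hg; apply (continuous_minus (V := C_R_NormedModule) f g x Hf Hg).
Qed.

Lemma Ccontinuous_mult (f g : R -> C) (x : R) :
  Ccontinuous f x -> Ccontinuous g x -> Ccontinuous (fun t => (f t * g t)%C) x.
Proof.
intros Hf Hg.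
pose proof (continuous_Re f x Hf); pose proof (continuous_Im f x Hf).
pose proof (continuous_Re g x Hg); pose proof (continuous_Im g x Hg).
apply Ccontinuous_intro; simpl.
- apply (continuous_minus (V := R_NormedModule));
    apply (continuous_mult (K := R_AbsRing)); assumption.
- apply (continuous_plus (V := R_NormedModule));
    apply (continuous_mult (K := R_AbsRing)); assumption.
Qed.

Lemma continuous_Cmod (f : R -> C) (x : R) :
  Ccontinuous f x -> continuous (fun t => Cmod (f t)) x.
Proof.
intros Hf; unfold Cmod; apply continuous_sqrt_comp.
apply (continuous_ext (fun t => Re (f t) * Re (f t) + Im (f t) * Im (f t))%R).
  intros t; unfold Re, Im; simpl; ring.
pose proof (continuous_Re f x Hf); pose proof (continuous_Im f x Hf).
apply (continuous_plus (V := R_NormedModule));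
  apply (continuous_mult (K := R_AbsRing)); assumption.
Qed.

Lemma Ccontinuous_inv (f : R -> C) (x : R) :
  Ccontinuous f x -> f x <> RtoC 0 -> Ccontinuous (fun t => (/ f t)%C) x.
Proof.
intros Hf H0.
assert (Hn : (Re (f x) ^ 2 + Im (f x) ^ 2)%R <> 0).
{ rewrite <- Cmod2_alt; apply pow_nonzero; intros E; apply H0, Cmod_eq_0, E. }
assert (Hc : continuous (fun t => / (Re (f t) ^ 2 + Im (f t) ^ 2))%R x).
{ apply continuous_Rinv_comp; [|exact Hn].
  apply (continuous_ext (fun t => Cmod (f t) * Cmod (f t))%R).
    intros t; rewrite <- Cmod2_alt; simpl; ring.
  apply (continuous_mult (K := R_AbsRing)); now apply continuous_Cmod. }
apply Ccontinuous_intro; simpl; apply (continuous_mult (K := R_AbsRing)); trivial.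
- now apply continuous_Re.
- apply (continuous_opp (V := R_NormedModule)); now apply continuous_Im.
Qed.

Lemma Ccontinuous_pow (f : R -> C) (n : nat) (x : R) :
  Ccontinuous f x -> Ccontinuous (fun t => (f t ^ n)%C) x.
Proof.
intros Hf; induction n as [|n IH]; simpl; [apply continuous_const|].
now apply Ccontinuous_mult.
Qed.

(** * Integrals and power series *)

Lemma ex_CRint_continuous (f : R -> C) (a b : R) :
  a <= b -> (forall x, a <= x <= b -> Ccontinuous f x) -> ex_CRint f a b.
Proof.
intros Hab Hf; apply (ex_RInt_continuous (V := C_R_CompleteNormedModule)).
intros x; rewrite Rmin_left, Rmax_right by exact Hab; apply Hf.
Qed.

Lemma Cmod_bounded_on_segment (f : R -> C) (a b : R) :
  a <= b -> (forall x, a <= x <= b -> Ccontinuous f x) ->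
  exists M, 0 <= M /\ forall x, a <= x <= b -> Cmod (f x) <= M.
Proof.
intros Hab Hf.
destruct (continuity_ab_maj (fun x => Cmod (f x)) a b Hab) as [m [Hm _]].
  intros x Hx; apply continuity_pt_filterlim, continuous_Cmod, Hf, Hx.
exists (Cmod (f m)); split; [apply Cmod_ge_0|exact Hm].
Qed.

(** The integral of a complex-valued function is built from its real module
    structure, so complex homogeneity has to be read off the components. *)
Lemma is_CRint_Cscal (c : C) (f : R -> C) (a b : R) (l : C) :
  is_CRint f a b l -> is_CRint (fun x => (c * f x)%C) a b (c * l)%C.
Proof.
intros Hf.
pose proof (is_RInt_fct_extend_fst f a b l Hf) as H1.
pose proof (is_RInt_fct_extend_snd f a b l Hf) as H2.
apply is_RInt_fct_extend_pair; simpl.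
- apply (is_RInt_minus (V := R_NormedModule));
    apply (is_RInt_scal (V := R_NormedModule)); assumption.
- apply (is_RInt_plus (V := R_NormedModule));
    apply (is_RInt_scal (V := R_NormedModule)); assumption.
Qed.

Lemma one_minus_neq_0 (c : C) (r : R) :
  r < 1 -> Cmod c <= r -> (1 - c)%C <> RtoC 0.
Proof.
intros Hr Hc E.
assert (E1 : c = RtoC 1) by (replace c with (1 - (1 - c))%C by ring; rewrite E; ring).
rewrite E1, Cmod_1 in Hc; lra.
Qed.

Lemma Cmod_one_minus_ge (c : C) (r : R) : Cmod c <= r -> 1 - r <= Cmod (1 - c).
Proof.
intros Hc; pose proof (Cmod_triangle (1 - c) c) as H.
replace (1 - c + c)%C with (RtoC 1) in H by ring.
rewrite Cmod_1 in H; lra.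
Qed.

Lemma pow_n_Cpow (z : C) (n : nat) : pow_n (K := C_Ring) z n = (z ^ n)%C.
Proof. induction n as [|n IH]; simpl; [|rewrite IH]; reflexivity. Qed.

Lemma Cmod_Cpow (z : C) (n : nat) : Cmod (z ^ n) = (Cmod z ^ n)%R.
Proof. induction n as [|n IH]; simpl; [apply Cmod_1|now rewrite Cmod_mult, IH]. Qed.

(** Geometric expansion under the integral sign.  The remainder after the term
    of index [N] is exactly [int p (h w)^(N+1) / (1 - h w)], hence bounded by
    [(b - a) B r^(N+1) / (1 - r)], where [B] bounds [p]. *)
Lemma moment_series (a b r : R) (p h : R -> C) (w : C) :
  a <= b -> r < 1 ->
  (forall x, a <= x <= b -> Ccontinuous p x) ->
  (forall x, a <= x <= b -> Ccontinuous h x) ->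
  (forall x, a <= x <= b -> Cmod (h x * w) <= r) ->
  is_Cpseries (fun n => CRint (fun x => (p x * h x ^ n)%C) a b) w
    (CRint (fun x => (p x * / (1 - h x * w))%C) a b).
Proof.
intros Hab Hr Hp Hh Hhw.
set (M := fun n => CRint _ a b).
set (L := CRint _ a b).
assert (Hhw0 : forall x, a <= x <= b -> (1 - h x * w)%C <> RtoC 0).
  intros x Hx; apply (one_minus_neq_0 _ r); auto.
assert (Hr0 : 0 <= r).
  apply Rle_trans with (2 := Hhw a (conj (Rle_refl a) Hab)); apply Cmod_ge_0.
assert (HL : is_CRint (fun x => (p x * / (1 - h x * w))%C) a b L).
{ apply (RInt_correct (V := C_R_CompleteNormedModule)), ex_CRint_continuous; trivial.
  intros x Hx; apply Ccontinuous_mult; [auto|].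
  apply Ccontinuous_inv; [|auto].
  apply Ccontinuous_minus; [apply continuous_const|].
  apply Ccontinuous_mult; [auto|apply continuous_const]. }
assert (HM : forall n, is_CRint (fun x => (p x * h x ^ n)%C) a b (M n)).
{ intros n; apply (RInt_correct (V := C_R_CompleteNormedModule)), ex_CRint_continuous; trivial.
  intros x Hx; apply Ccontinuous_mult; [auto|apply Ccontinuous_pow; auto]. }
assert (Htail : forall N, is_CRint
  (fun x => (p x * (h x * w) ^ S N * / (1 - h x * w))%C) a b
  (L - sum_n (G := C_AbelianMonoid) (fun n => w ^ n * M n)%C N)%C).
{ (* [y^(N+1) / (1 - y) = y^N / (1 - y) - y^N] with [y = h x * w]. *)
  assert (Hstep : forall N (T : C), is_CRint
      (fun x => (p x * (h x * w) ^ N * / (1 - h x * w))%C) a b T ->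
    is_CRint
      (fun x => (p x * (h x * w) ^ S N * / (1 - h x * w))%C) a b (T - w ^ N * M N)%C).
  { intros N T HT.
    pose proof (is_CRint_Cscal (w ^ N)%C _ a b _ (HM N)) as H.
    eapply is_RInt_ext; [|exact (is_RInt_minus _ _ a b _ _ HT H)].
    rewrite Rmin_left, Rmax_right by exact Hab.
    intros x Hx; unfold minus; simpl.
    change (p x * (h x * w) ^ N * / (1 - h x * w) - w ^ N * (p x * h x ^ N)
      = p x * ((h x * w) * (h x * w) ^ N) * / (1 - h x * w))%C.
    rewrite Cpow_mult_l; field; apply Hhw0; lra. }
  intros N; induction N as [|N IH].
  - rewrite sum_O; apply Hstep.
    eapply is_RInt_ext; [|exact HL].
    intros x _; simpl; ring.
  - rewrite sum_Sn.
    replace (L - _)%C with (L - sum_n (G := C_AbelianMonoid) (fun n => w ^ n * M n)%C N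
      - w ^ S N * M (S N))%C.
    + now apply Hstep.
    + unfold plus; simpl; ring. }
destruct (Cmod_bounded_on_segment p a b Hab Hp) as [B [HB0 HB]].
assert (Hbound : forall N, Cmod (L - sum_n (G := C_AbelianMonoid) (fun n => w ^ n * M n)%C N)
   <= (b - a) * (B * / (1 - r)) * r ^ S N).
{ intros N; rewrite Cmod_norm, Rmult_assoc.
  apply (norm_RInt_le_const _ a b _ (B * / (1 - r) * r ^ S N) Hab) with (2 := Htail N).
  intros x Hx; rewrite <- Cmod_norm.
  rewrite !Cmod_mult, Cmod_inv, Cmod_Cpow by auto.
  replace (B * / (1 - r) * r ^ S N)%R with (B * r ^ S N * / (1 - r))%R by ring.
  apply Rmult_le_compat.
  - apply Rmult_le_pos; [apply Cmod_ge_0|apply pow_le, Cmod_ge_0].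
  - left; apply Rinv_0_lt_compat, Cmod_gt_0; auto.
  - apply Rmult_le_compat; [apply Cmod_ge_0|apply pow_le, Cmod_ge_0|auto|].
    apply pow_incr; split; [apply Cmod_ge_0|auto].
  - apply Rinv_le_contravar; [lra|apply Cmod_one_minus_ge; auto]. }
apply (is_series_ext (V := C_NormedModule) (fun n => w ^ n * M n)%C).
  intros n; rewrite <- pow_n_Cpow; reflexivity.
apply (filterlim_locally_ball_norm (U := C_NormedModule)).
intros eps.
assert (Hlim : is_lim_seq (fun N => (b - a) * (B * / (1 - r)) * r ^ S N)%R 0).
{ rewrite <- (Rmult_0_r ((b - a) * (B * / (1 - r)))).
  apply (is_lim_seq_scal_l (fun N => r ^ S N)%R _ 0).
  apply (is_lim_seq_incr_1 (fun N => r ^ N)%R), is_lim_seq_geom.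
  rewrite Rabs_pos_eq; lra. }
apply is_lim_seq_spec in Hlim; specialize (Hlim eps); simpl in Hlim.
revert Hlim; apply filter_imp; intros N HN.
rewrite Rminus_0_r in HN.
unfold ball_norm.
change (Cmod (sum_n (G := C_AbelianMonoid) (fun n => w ^ n * M n)%C N - L) < eps).
rewrite <- Cmod_opp.
replace (- (_ - L))%C
  with (L - sum_n (G := C_AbelianMonoid) (fun n => w ^ n * M n)%C N)%C by ring.
apply Rle_lt_trans with (1 := Hbound N), Rle_lt_trans with (2 := HN), Rle_abs.
Qed.

Lemma RtoC_1_neq_0 : RtoC 1 <> RtoC 0.
Proof. intros E; injection E; lra. Qed.

(** * Integrals of resolvents *)

Definition resolvent_integral (g v : R -> R) (a b : R) (z : C) : C :=
  CRint (fun x => (g x * / (1 - v x * z))%C) a b.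

Definition regular_at (v : R -> R) (a b : R) (z : C) : Prop :=
  forall x, a <= x <= b -> (1 - v x * z)%C <> RtoC 0.

Section ResolventIntegral.

Context (g v : R -> R) (a b : R).
Context (Hab : a <= b).
Context (Hg : forall x, a <= x <= b -> continuous g x).
Context (Hv : forall x, a <= x <= b -> continuous v x).

Lemma Ccontinuous_one_minus (z : C) (x : R) :
  a <= x <= b -> Ccontinuous (fun t => (1 - v t * z)%C) x.
Proof using Hv.
intros Hx; apply Ccontinuous_minus; [apply continuous_const|].
apply Ccontinuous_mult; [apply Ccontinuous_RtoC; auto|apply continuous_const].
Qed.

Lemma resolvent_integrand_continuous (z : C) :
  regular_at v a b z -> forall x, a <= x <= b ->
  Ccontinuous (fun t => (g t * / (1 - v t * z))%C) x.
Proof using Hg Hv.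
intros Hz x Hx; apply Ccontinuous_mult; [apply Ccontinuous_RtoC; auto|].
apply Ccontinuous_inv; [now apply Ccontinuous_one_minus|auto].
Qed.

(** By compactness of [[a, b]] the ratio [v / (1 - v z0)] is bounded, which
    gives a disk around [z0] with a convergence rate uniform in [x]. *)
Lemma regular_ratio_small (z0 : C) :
  regular_at v a b z0 ->
  locally (T := C_UniformSpace) z0 (fun z => forall x, a <= x <= b ->
    Cmod (v x * / (1 - v x * z0) * (z - z0)) <= / 2).
Proof using Hab Hv.
intros Hz0.
destruct (Cmod_bounded_on_segment (fun x => (v x * / (1 - v x * z0))%C) a b Hab)
  as [B [HB0 HB]].
{ intros x Hx; apply Ccontinuous_mult; [apply Ccontinuous_RtoC; auto|].
  apply Ccontinuous_inv; [now apply Ccontinuous_one_minus|auto]. }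
(* [B + 1] rather than [B], as [B] may be [0]. *)
assert (Hd : 0 < / (2 * (B + 1))) by (apply Rinv_0_lt_compat; lra).
apply (filter_imp _ _) with (2 := locally_ball_norm (V := C_NormedModule) z0 (mkposreal _ Hd)).
intros z Hz x Hx.
change (Cmod (z - z0) < / (2 * (B + 1))) in Hz.
rewrite Cmod_mult.
apply Rle_trans with (B * / (2 * (B + 1)))%R.
- apply Rmult_le_compat; [apply Cmod_ge_0|apply Cmod_ge_0|auto|lra].
- apply Rmult_le_reg_r with (2 * (B + 1))%R; [lra|].
  field_simplify; lra.
Qed.

Lemma one_minus_factor (z0 z : C) (x : R) :
  (1 - v x * z0)%C <> RtoC 0 ->
  ((1 - v x * z0) * (1 - v x * / (1 - v x * z0) * (z - z0)) = 1 - v x * z)%C.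
Proof using. intros H; field; exact H. Qed.

Lemma locally_regular (z0 : C) :
  regular_at v a b z0 ->
  locally (T := C_UniformSpace) z0 (regular_at v a b).
Proof using Hab Hv.
intros Hz0; apply (filter_imp _ _) with (2 := regular_ratio_small z0 Hz0).
intros z Hz x Hx; rewrite <- (one_minus_factor z0) by auto.
apply Cmult_neq_0; [auto|apply (one_minus_neq_0 _ (/ 2)); [lra|auto]].
Qed.

(** Factoring [1 - v z = (1 - v z0) (1 - h (z - z0))] with
    [h = v / (1 - v z0)] turns the integrand into a geometric series in
    [z - z0]. *)
Lemma resolvent_integral_expansion (z0 : C) :
  regular_at v a b z0 ->
  locally (T := C_UniformSpace) z0 (fun z =>
    is_Cpseries
      (fun n => CRint (fun x => (g x * / (1 - v x * z0) * (v x * / (1 - v x * z0)) ^ n)%C) a b)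
      (z - z0)%C (resolvent_integral g v a b z)).
Proof using Hab Hg Hv.
intros Hz0; apply (filter_imp _ _) with (2 := regular_ratio_small z0 Hz0).
intros z Hz.
replace (resolvent_integral g v a b z) with
  (CRint (fun x => (g x * / (1 - v x * z0)
      * / (1 - v x * / (1 - v x * z0) * (z - z0)))%C) a b).
- apply moment_series with (/ 2)%R; try lra; trivial.
  + now apply resolvent_integrand_continuous.
  + intros x Hx; apply Ccontinuous_mult; [apply Ccontinuous_RtoC; auto|].
    apply Ccontinuous_inv; [now apply Ccontinuous_one_minus|auto].
- apply (RInt_ext (V := C_R_CompleteNormedModule)).
  rewrite Rmin_left, Rmax_right by exact Hab; intros x Hx.
  assert (Hx' : a <= x <= b) by lra.
  assert (Hw := one_minus_neq_0 _ (/ 2) ltac:(lra) (Hz x Hx')).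
  rewrite <- (one_minus_factor z0 z x) by auto.
  specialize (Hz0 x Hx').
  set (d := (1 - v x * z0)%C) in *; set (e := (1 - v x * / d * (z - z0))%C) in *.
  change (g x * / d * / e = g x * / (d * e))%C.
  field; auto.
Qed.

Lemma regular_at_0 : regular_at v a b (RtoC 0).
Proof using.
intros x _; replace (1 - v x * 0)%C with (RtoC 1) by ring.
exact RtoC_1_neq_0.
Qed.

Lemma resolvent_integral_moments :
  locally (T := C_UniformSpace) (RtoC 0) (fun z =>
    is_Cpseries (fun n => CRint (fun x => RtoC (g x * v x ^ n)) a b) z
      (resolvent_integral g v a b z)).
Proof using Hab Hg Hv.
apply (filter_imp _ _) with (2 := resolvent_integral_expansion _ regular_at_0).
intros z Hz.
assert (Ez : forall y : C, (y - 0)%C = y) by (intros y; ring).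
rewrite Ez in Hz.
eapply is_pseries_ext; [|exact Hz].
intros n; cbv beta; apply (RInt_ext (V := C_R_CompleteNormedModule)); intros x _.
replace (1 - v x * 0)%C with (RtoC 1) by ring.
rewrite <- RtoC_inv, Rinv_1, !Cmult_1_r, RtoC_mult, RtoC_pow by lra.
reflexivity.
Qed.

Lemma resolvent_integral_analytic (z0 : C) :
  regular_at v a b z0 -> analytic_at (resolvent_integral g v a b) z0.
Proof using Hab Hg Hv.
intros Hz0; eexists; exact (resolvent_integral_expansion z0 Hz0).
Qed.

(** This is [1 / (1 - 1/(v z)) = 1 - 1 / (1 - v z)] under the integral, the
    constant [1] contributing [int g], the value at [0]. *)
Lemma resolvent_integral_reflection (z : C) :
  (forall x, a <= x <= b -> v x <> 0) ->
  z <> RtoC 0 -> regular_at v a b z ->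
  (resolvent_integral g (fun x => / v x)%R a b (/ z) =
    resolvent_integral g v a b (RtoC 0) - resolvent_integral g v a b z)%C.
Proof using Hab Hg Hv.
intros Hv0 Hz Hreg; apply (is_RInt_unique (V := C_R_CompleteNormedModule)).
assert (Hint : forall y, regular_at v a b y -> is_CRint
    (fun x => (g x * / (1 - v x * y))%C) a b (resolvent_integral g v a b y)).
{ intros y Hy; apply (RInt_correct (V := C_R_CompleteNormedModule)).
  now apply ex_CRint_continuous, resolvent_integrand_continuous. }
eapply is_RInt_ext; [|exact (is_RInt_minus _ _ a b _ _
  (Hint _ regular_at_0) (Hint _ Hreg))].
rewrite Rmin_left, Rmax_right by exact Hab; intros x Hx.
assert (Hx' : a <= x <= b) by lra.
change (g x * / (1 - v x * 0) - g x * / (1 - v x * z)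
  = g x * / (1 - (/ v x)%R * / z))%C.
rewrite RtoC_inv by auto.
assert (H1 := Hreg x Hx').
assert (Hvx : RtoC (v x) <> RtoC 0) by (intros E; apply (Hv0 x Hx'); now injection E).
field; repeat split; trivial.
intros E; apply H1; replace (1 - v x * z)%C with (- (v x * z - 1))%C by ring.
rewrite E; ring.
Qed.

End ResolventIntegral.

(** * Stability of analyticity *)

Lemma analytic_at_ext_loc (f h : C -> C) (z0 : C) :
  locally (T := C_UniformSpace) z0 (fun z => f z = h z) ->
  analytic_at f z0 -> analytic_at h z0.
Proof.
intros Hfh [c Hc]; exists c.
apply (filter_imp _ _) with (2 := filter_and _ _ Hfh Hc).
intros z [<- H]; exact H.
Qed.

Lemma analytic_at_opp (f : C -> C) (z0 : C) :
  analytic_at f z0 -> analytic_at (fun z => (- f z)%C) z0.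
Proof.
intros [c Hc]; exists (PS_opp (V := C_NormedModule) c).
apply (filter_imp _ _) with (2 := Hc); intros z Hz.
now apply (is_pseries_opp (V := C_NormedModule)).
Qed.

Lemma is_pseries_change_head (c c' : nat -> C) (z l : C) :
  (forall n, c' (S n) = c (S n)) ->
  is_Cpseries c z l -> is_Cpseries c' z (l - c O + c' O)%C.
Proof.
intros Heq Hc; apply (is_series_decr_1 (V := C_NormedModule)).
apply (is_series_ext (V := C_NormedModule) (fun n => scal (pow_n z (S n)) (c (S n)))).
  intros n; now rewrite Heq.
apply (is_series_incr_1 (V := C_NormedModule)
  (fun n => scal (pow_n z n) (c n))).
assert (Hs : forall y : C, scal (V := C_NormedModule) (pow_n (K := C_AbsRing) z 0) y = y).
  intros y; apply (scal_one (V := C_NormedModule)).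
rewrite !Hs.
replace (plus _ _) with l; [exact Hc|].
unfold plus, opp; simpl; ring.
Qed.

Lemma analytic_at_minus_const (f : C -> C) (k z0 : C) :
  analytic_at f z0 -> analytic_at (fun z => (f z - k)%C) z0.
Proof.
intros [c Hc]; exists (fun n => match n with O => c O - k | S _ => c n end)%C.
apply (filter_imp _ _) with (2 := Hc); intros z Hz.
set (c' := fun n : nat => _).
replace (f z - k)%C with (f z - c O + c' O)%C by (unfold c'; ring).
now apply is_pseries_change_head.
Qed.

(** * The spectral measure of the tree *)

Lemma pos_Cpow_RtoC (x s : R) : pos_Cpow x (RtoC s) = RtoC (Rpower x s).
Proof.
unfold pos_Cpow, Cexp, Rpower; rewrite <- RtoC_mult; simpl.
rewrite cos_0, sin_0; apply Cmult_1_r.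
Qed.

Definition spectral_edge (q : nat) : R := 2 * sqrt (INR q).

(** Density of the spectral measure of the adjacency operator at the root, the
    prefactor of the integral defining [zeta] included. *)
Definition spectral_density (q : nat) (x : R) : R :=
  (INR q + 1) / (2 * PI)
  * (sqrt (4 * INR q - x ^ 2) / ((INR q + 1) ^ 2 - x ^ 2)).

Definition laplacian_value (q : nat) (x : R) : R := INR q + 1 - x.

Section Tree.

Context (q : nat).
Context (Hq : (1 < q)%nat).

Local Notation e := (spectral_edge q).
Local Notation rho := (spectral_density q).
Local Notation u := (laplacian_value q).

Lemma sqrt_INR_gt_1 : 1 < sqrt (INR q).
Proof using Hq.
rewrite <- sqrt_1; apply sqrt_lt_1_alt; split; [lra|].
now apply (lt_INR 1).
Qed.

Lemma sqr_sqrt_INR : sqrt (INR q) * sqrt (INR q) = INR q.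
Proof using. apply sqrt_sqrt, pos_INR. Qed.

Lemma edge_order : - e <= e.
Proof using Hq. unfold spectral_edge; pose proof sqrt_INR_gt_1; lra. Qed.

Lemma laplacian_value_range (x : R) :
  - e <= x <= e -> (sqrt (INR q) - 1) ^ 2 <= u x <= (sqrt (INR q) + 1) ^ 2.
Proof using.
unfold spectral_edge, laplacian_value; intros Hx; pose proof sqr_sqrt_INR; nra.
Qed.

Lemma laplacian_value_pos (x : R) : - e <= x <= e -> 0 < u x.
Proof using Hq.
intros Hx; pose proof (laplacian_value_range x Hx); pose proof sqrt_INR_gt_1; nra.
Qed.

Lemma laplacian_value_continuous (x : R) : continuous u x.
Proof using.
apply (continuous_minus (V := R_NormedModule)); [apply continuous_const|apply continuous_id].
Qed.

Lemma inv_laplacian_value_continuous (x : R) :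
  - e <= x <= e -> continuous (fun t => / u t) x.
Proof using Hq.
intros Hx; apply continuous_Rinv_comp; [apply laplacian_value_continuous|].
apply Rgt_not_eq, laplacian_value_pos, Hx.
Qed.

Lemma spectral_density_continuous (x : R) : - e <= x <= e -> continuous rho x.
Proof using Hq.
intros Hx.
assert (Hsq : continuous (fun t => t ^ 2)%R x).
{ apply (continuous_ext (fun t => t * t)%R); [intros t; simpl; ring|].
  apply (continuous_mult (K := R_AbsRing)); apply continuous_id. }
assert (Hc : forall c : R, continuous (fun t => c - t ^ 2)%R x).
{ intros c; apply (continuous_minus (V := R_NormedModule)); [apply continuous_const|exact Hsq]. }
apply (continuous_mult (K := R_AbsRing)); [apply continuous_const|].
apply (continuous_mult (K := R_AbsRing)); [apply continuous_sqrt_comp, Hc|].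
apply continuous_Rinv_comp; [apply Hc|].
unfold spectral_edge in Hx.
pose proof sqr_sqrt_INR; pose proof sqrt_INR_gt_1.
apply Rgt_not_eq.
replace ((INR q + 1) ^ 2 - x ^ 2)%R with ((INR q + 1 - x) * (INR q + 1 + x))%R by ring.
apply Rmult_gt_0_compat; nra.
Qed.

(** [zeta] at a real argument is a moment.  The power is passed as a separate
    function [m] so that integer powers of [u] or [/ u], rather than
    [Rpower], appear under the integral. *)
Lemma zeta_eq_moment (s : R) (m : R -> R) :
  (forall x, - e <= x <= e -> continuous m x) ->
  (forall x, - e <= x <= e -> Rpower (u x) (- s) = m x) ->
  zeta q (RtoC s) = CRint (fun x => RtoC (rho x * m x)) (- e) e.
Proof using Hq.
intros Hm Hpow; unfold zeta; fold e.
set (K := (INR q + 1) / (2 * PI)).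
assert (HK : K <> 0).
{ apply Rgt_not_eq, Rdiv_lt_0_compat; pose proof PI_RGT_0; pose proof (pos_INR q); lra. }
set (F := fun x : R => _); symmetry.
assert (HF : forall x, - e <= x <= e -> (K * F x = RtoC (rho x * m x))%C).
{ intros x Hx; unfold F.
  rewrite <- RtoC_opp, pos_Cpow_RtoC; fold (u x).
  rewrite Hpow by exact Hx.
  rewrite <- !RtoC_mult; f_equal; unfold spectral_density; fold K; ring. }
assert (Hex : ex_CRint F (- e) e).
{ apply ex_RInt_ext with (fun x => (/ K * RtoC (rho x * m x))%C).
  - rewrite Rmin_left, Rmax_right by apply edge_order.
    intros x Hx; rewrite <- HF by lra.
    assert (RtoC K <> RtoC 0) by (intros E; now injection E).
    set (y := F x); change (/ K * (K * y) = y)%C; field; assumption.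
  - apply ex_CRint_continuous; [apply edge_order|].
    intros x Hx; apply Ccontinuous_mult; [apply continuous_const|].
    apply Ccontinuous_RtoC, (continuous_mult (K := R_AbsRing)); [|auto].
    now apply spectral_density_continuous. }
apply (is_RInt_unique (V := C_R_CompleteNormedModule)).
apply is_RInt_ext with (fun x => (K * F x)%C).
- rewrite Rmin_left, Rmax_right by apply edge_order.
  intros x Hx; apply HF; lra.
- apply is_CRint_Cscal, (RInt_correct (V := C_R_CompleteNormedModule)), Hex.
Qed.

Lemma zeta_neg_INR (n : nat) :
  zeta q (RtoC (- INR n)) = CRint (fun x => RtoC (rho x * u x ^ n)) (- e) e.
Proof using Hq.
apply (zeta_eq_moment _ (fun x => u x ^ n)%R).
- intros x _; apply continuous_Rpow, laplacian_value_continuous.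
- intros x Hx; rewrite Ropp_involutive; apply Rpower_pow, laplacian_value_pos, Hx.
Qed.

Lemma zeta_INR (n : nat) :
  zeta q (RtoC (INR n)) = CRint (fun x => RtoC (rho x * (/ u x) ^ n)) (- e) e.
Proof using Hq.
apply (zeta_eq_moment _ (fun x => (/ u x) ^ n)%R).
- intros x Hx; now apply continuous_Rpow, inv_laplacian_value_continuous.
- intros x Hx; rewrite Rpower_Ropp, Rpower_pow by now apply laplacian_value_pos.
  symmetry; apply pow_inv.
Qed.

(** * The two continuations *)

Definition zeta_neg_gf (z : C) : C := resolvent_integral rho u (- e) e z.
Definition zeta_pos_gf (z : C) : C :=
  resolvent_integral rho (fun x => / u x)%R (- e) e z.

(** The integrand of [zeta_neg_gf] tends to [0] at infinity, whence the value
    at [Inf]. *)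
Definition Gminus_cont (p : P1C) : C :=
  match p with Fin z => zeta_neg_gf z | Inf => RtoC 0 end.

(** The series for [G_+] starts at [n = 1], whereas [zeta_pos_gf] also has the
    term [n = 0], which is subtracted.  At infinity only that correction
    survives. *)
Definition Gplus_cont (p : P1C) : C :=
  match p with
  | Fin z => (zeta_pos_gf z - zeta q (RtoC 0))%C
  | Inf => (- zeta q (RtoC 0))%C
  end.

Lemma resolvent_at_0 (v : R -> R) :
  resolvent_integral rho v (- e) e (RtoC 0) = zeta q (RtoC 0).
Proof using Hq.
transitivity (zeta q (RtoC (INR 0))); [|reflexivity].
rewrite zeta_INR; apply (RInt_ext (V := C_R_CompleteNormedModule)); intros x _.
replace (1 - v x * 0)%C with (RtoC 1) by ring.
rewrite <- RtoC_inv, Rinv_1, RtoC_mult, Cmult_1_r by lra.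
simpl; now rewrite Cmult_1_r.
Qed.

Lemma regular_off_Omega_plus (z : C) :
  ~ Omega_plus q (Fin z) -> regular_at (fun x => / u x)%R (- e) e z.
Proof using Hq.
intros Hz x Hx E; apply Hz; exists (u x).
split; [now apply laplacian_value_range|].
assert (Hu := laplacian_value_pos x Hx).
assert (RtoC (u x) <> RtoC 0) by (intros E'; injection E'; lra).
f_equal; replace z with (u x * (1 - (1 - (/ u x)%R * z)))%C.
- rewrite E; ring.
- rewrite RtoC_inv by lra; field; assumption.
Qed.

Lemma regular_off_Omega_minus (z : C) :
  ~ Omega_minus q (Fin z) -> regular_at u (- e) e z.
Proof using Hq.
intros Hz x Hx E; apply Hz; exists (Fin (RtoC (u x))).
split.
- exists (u x); split; [now apply laplacian_value_range|reflexivity].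
- assert (Hu := laplacian_value_pos x Hx).
  assert (RtoC (u x) <> RtoC 0) by (intros E'; injection E'; lra).
  simpl; destruct (Ceq_dec (RtoC (u x)) (RtoC 0)) as [E'|_]; [contradiction|].
  f_equal; replace z with (/ u x * (1 - (1 - u x * z)))%C.
  + rewrite E; ring.
  + field; assumption.
Qed.

Lemma zeta_neg_gf_inv (z : C) :
  z <> RtoC 0 -> regular_at (fun x => / u x)%R (- e) e z ->
  zeta_neg_gf (/ z) = (zeta q (RtoC 0) - zeta_pos_gf z)%C.
Proof using Hq.
intros Hz Hreg.
rewrite <- (resolvent_at_0 (fun x => / u x)%R).
unfold zeta_pos_gf; rewrite <- resolvent_integral_reflection; trivial.
- apply (RInt_ext (V := C_R_CompleteNormedModule)); intros x _; now rewrite Rinv_inv.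
- apply edge_order.
- apply spectral_density_continuous.
- apply inv_laplacian_value_continuous.
- intros x Hx; apply Rinv_neq_0_compat, Rgt_not_eq, laplacian_value_pos, Hx.
Qed.

Lemma zeta_pos_gf_inv (z : C) :
  z <> RtoC 0 -> regular_at u (- e) e z ->
  zeta_pos_gf (/ z) = (zeta q (RtoC 0) - zeta_neg_gf z)%C.
Proof using Hq.
intros Hz Hreg.
rewrite <- (resolvent_at_0 u).
unfold zeta_pos_gf; rewrite resolvent_integral_reflection; trivial.
- apply edge_order.
- apply spectral_density_continuous.
- intros x _; apply laplacian_value_continuous.
- intros x Hx; apply Rgt_not_eq, laplacian_value_pos, Hx.
Qed.

(** The points [0] and [Inf] are treated apart: the reflection formula
    requires a nonzero finite argument, and there the two values cancel because
    every resolvent integral equals [zeta q 0] at [0]. *)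
Lemma Gplus_plus_Gminus (p : P1C) :
  ~ Omega_plus q p -> (Gplus_cont p + Gminus_cont (P1C_inv p) = 0)%C.
Proof using Hq.
intros Hp; destruct p as [z|]; simpl.
- destruct (Ceq_dec z (RtoC 0)) as [->|Hz]; simpl.
  + unfold zeta_pos_gf; rewrite resolvent_at_0; ring.
  + rewrite zeta_neg_gf_inv; [ring|exact Hz|now apply regular_off_Omega_plus].
- unfold zeta_neg_gf; rewrite resolvent_at_0; ring.
Qed.

Lemma zeta_neg_gf_analytic (z : C) :
  regular_at u (- e) e z -> analytic_at zeta_neg_gf z.
Proof using Hq.
apply resolvent_integral_analytic.
- apply edge_order.
- apply spectral_density_continuous.
- intros x _; apply laplacian_value_continuous.
Qed.

Lemma zeta_pos_gf_minus_zeta_analytic (z : C) :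
  regular_at (fun x => / u x)%R (- e) e z ->
  analytic_at (fun y => zeta_pos_gf y - zeta q (RtoC 0))%C z.
Proof using Hq.
intros Hz; apply analytic_at_minus_const.
revert Hz; apply resolvent_integral_analytic.
- apply edge_order.
- apply spectral_density_continuous.
- apply inv_laplacian_value_continuous.
Qed.

Lemma Gminus_continuation :
  analytic_continuation (Gminus_coef q) (fun p => ~ Omega_minus q p) Gminus_cont.
Proof using Hq.
split.
- apply (filter_imp _ _) with (2 := resolvent_integral_moments rho u (- e) e
    edge_order spectral_density_continuous
    (fun x _ => laplacian_value_continuous x)).
  intros z Hz; eapply is_pseries_ext; [|exact Hz].
  intros n; symmetry; apply zeta_neg_INR.
- intros [z|] Hp; simpl.
  + now apply zeta_neg_gf_analytic, regular_off_Omega_minus.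
  (* At infinity the reflection expresses the function in the chart [1/z]
     through the other generating function near [0]. *)
  + apply analytic_at_ext_loc with (fun z => - (zeta_pos_gf z - zeta q (RtoC 0)))%C.
    * apply (filter_imp _ _) with (2 := locally_regular (fun x => / u x)%R (- e) e
        edge_order inv_laplacian_value_continuous _ (regular_at_0 _ _ _)).
      intros z Hz; destruct (Ceq_dec z (RtoC 0)) as [->|Hz0]; simpl.
      -- unfold zeta_pos_gf; rewrite resolvent_at_0; ring.
      -- rewrite zeta_neg_gf_inv; trivial; ring.
    * apply analytic_at_opp, zeta_pos_gf_minus_zeta_analytic, regular_at_0.
Qed.

Lemma Gplus_continuation :
  analytic_continuation (Gplus_coef q) (fun p => ~ Omega_plus q p) Gplus_cont.
Proof using Hq.
split.
- apply (filter_imp _ _) with (2 := resolvent_integral_moments rho (fun x => / u x)%R (- e) e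
    edge_order spectral_density_continuous inv_laplacian_value_continuous).
  intros z Hz; simpl.
  assert (Hs : is_Cpseries (fun n => zeta q (RtoC (INR n))) z (zeta_pos_gf z)).
  { eapply is_pseries_ext; [|exact Hz]; intros n; symmetry; apply zeta_INR. }
  (* The [n = 0] coefficient [zeta q 0] is replaced by [0]. *)
  replace (zeta_pos_gf z - zeta q (RtoC 0))%C
    with (zeta_pos_gf z - zeta q (RtoC (INR 0)) + Gplus_coef q 0)%C.
  + apply (is_pseries_change_head (fun n => zeta q (RtoC (INR n)))); trivial.
  + simpl; ring.
- intros [z|] Hp; simpl.
  + now apply zeta_pos_gf_minus_zeta_analytic, regular_off_Omega_plus.
  (* At infinity the reflection expresses the function in the chart [1/z]
     through the other generating function near [0]. *)
  + apply analytic_at_ext_loc with (fun z => - zeta_neg_gf z)%C.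
    * apply (filter_imp _ _) with (2 := locally_regular u (- e) e
        edge_order (fun x _ => laplacian_value_continuous x) _ (regular_at_0 _ _ _)).
      intros z Hz; destruct (Ceq_dec z (RtoC 0)) as [->|Hz0]; simpl.
      -- unfold zeta_neg_gf; rewrite resolvent_at_0; ring.
      -- rewrite zeta_pos_gf_inv; trivial; ring.
    * apply analytic_at_opp, zeta_neg_gf_analytic, regular_at_0.
Qed.

End Tree.

Theorem theorem1p2 :
  forall q : nat, (1 < q)%nat ->
  exists Gplus Gminus : P1C -> C,
    analytic_continuation (Gplus_coef q)
      (fun p : P1C => ~ Omega_plus q p) Gplus /\
    analytic_continuation (Gminus_coef q)
      (fun p : P1C => ~ Omega_minus q p) Gminus /\
    forall z : P1C, ~ Omega_plus q z ->
      Cplus (Gplus z) (Gminus (P1C_inv z)) = RtoC 0.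
Proof.
intros q Hq; exists (Gplus_cont q), (Gminus_cont q).
split; [now apply Gplus_continuation|].
split; [now apply Gminus_continuation|].
intros z Hz; now apply Gplus_plus_Gminus.
Qed.
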